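(* Let $n=p+q$, let $b$ be a non-degenerate symmetric bilinear form of signature $(p,q)$ on $\mathbb R^n$, let $1\le i\le n-1$, and let $E\to Gr(i,\mathbb R^{n})$ be the tautological bundle. Let $\sigma_i$ be the section of the density bundle $L:=S^2(\Lambda^iE^* )$ whose value at $V\in Gr(i,\mathbb R^n)$ is the bilinear form on $\Lambda^iV$ given by $$\sigma_i(V)(v_1\wedge\dots\wedge v_i,\,w_1\wedge\dots\wedge w_i)=\det\big((b(v_a,w_c))_{a,c=1,\dots,i}\big).$$ Then $\sigma_i$ is a defining density for each of the orbits $\mathcal O_{(r,s)}\subset Gr(i,\mathbb R^{p+q})$ with $r+s=i-1$.
   Context: $\mathcal O_{(r,s)}\subset Gr(i,\mathbb R^n)$ is the orbit, under $H=SO(p,q)$ (the special orthogonal group of $b$), consisting of the $i$-dimensional subspaces $W$ for which $b|_{W\times W}$ has signature $(r,s)$; for $r+s=i-1$ it is (if non-empty) an embedded hypersurface. The fiber of $E$ over $V$ is $V$. A section $\sigma$ of a line bundle (density bundle) $L\to M$ is a defining density for a hypersurface $N\subset M$ if for each $y\in N$ we have $\sigma(y)=0$ and the linear map $\nabla\sigma(y):T_yM\to L_y$ is surjective (i.e. non-zero), where $\nabla$ is any linear connection on $L$ (the map is independent of the choice since $\sigma(y)=0$). *)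

(* Defs.v *)
From HB Require Import structures.
From mathcomp Require Import all_boot all_order all_algebra.
From mathcomp Require Import sesquilinear.
From mathcomp Require Import all_classical all_reals all_analysis.
Import Order.TTheory GRing.Theory Num.Theory.
Import numFieldNormedType.Exports.

Set Implicit Arguments.
Unset Strict Implicit.
Unset Printing Implicit Defensive.

Local Open Scope classical_set_scope.
Local Open Scope ring_scope.

(* [f] is of class C^k at the points of [U]; meant for open [U]. *)
Fixpoint class_C (R : realType) (W : normedModType R) (k : nat)
    (U : set W) (f : W -> R) : Prop :=
  (forall x, U x -> {for x, continuous f}) /\
  match k with
  | 0 => True
  | k'.+1 => forall v : W,
      (forall x, U x -> derivable f x v) /\ class_C k' U (fun x => 'D_v f x)
  end.

Definition smooth_on (R : realType) (W : normedModType R)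
    (U : set W) (f : W -> R) : Prop := forall k, class_C k U f.

Section Grassmannian.
Context (R : realType) (i n : nat).

Definition Gr : Type := {V : {vspace 'rV[R]_n} | \dim V == i}.

(* The tautological bundle: the fiber over V is V itself. *)
Definition taut (V : Gr) : vectType R := subvs_of (val V).

(* The manifold structure of Gr is the one making [span_rows], from the open
   set of matrices of rank i onto Gr, a surjective submersion (Gr as the
   quotient of the frames by GL_i): f is smooth iff its pullback to the
   frames is.  The pullbacks below get a dummy value 0 outside of [frames]. *)
Definition frames : set 'M[R]_(i, n) := [set A | row_free A].

Definition span_rows (A : 'M[R]_(i, n)) : {vspace 'rV[R]_n} :=
  <<[seq row k A | k : 'I_i]>>%VS.

Definition smooth (f : Gr -> R) : Prop :=
  smooth_on frames (fun A => oapp f 0 (insub (span_rows A))).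

(* Tangent vectors are derivations at V of the algebra of smooth functions,
   extended by 0 to the functions that are not smooth, so that two tangent
   vectors are equal iff they agree on smooth functions. *)
Definition tangent (V : Gr) : set ((Gr -> R) -> R) :=
  [set X | [/\ forall (a : R) f g, smooth f -> smooth g ->
                 X (fun W => a * f W + g W) = a * X f + X g,
               forall f g, smooth f -> smooth g ->
                 X (fun W => f W * g W) = X f * g V + f V * X g
             & forall f, ~ smooth f -> X f = 0]].

Definition smooth_vector_field (xi : Gr -> (Gr -> R) -> R) : Prop :=
  (forall V, tangent V (xi V)) /\
  (forall f, smooth f -> smooth (fun V => xi V f)).

Definition alternating_form (U : vectType R) (w : ('I_i -> U) -> R) : Prop :=
  (forall (v : 'I_i -> U) k a x y,
     w (dfwith v k (a *: x + y)) = a * w (dfwith v k x) + w (dfwith v k y)) /\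
  (forall v j k, j != k -> v j = v k -> w v = 0).

(* By the universal property of the exterior power, a symmetric bilinear form
   beta on the i-th exterior power of V is a function B of 2i vectors of V
   that is alternating multilinear in each half and symmetric under exchange
   of the halves:
     B v w = beta (v_1 /\ ... /\ v_i) (w_1 /\ ... /\ w_i).
   [density_fiber V] is the fiber at V of L = S^2(Lambda^i E^* ). *)
Definition multiform (V : Gr) : Type :=
  ('I_i -> taut V) -> ('I_i -> taut V) -> R.

Definition density_fiber (V : Gr) : set (multiform V) :=
  [set B | [/\ forall w, alternating_form (B ^~ w),
               forall v, alternating_form (B v)
             & forall v w, B v w = B w v]].

(* A frame A trivializes the line L_V, for V = span_rows A, by evaluation at
   (a_1 /\ ... /\ a_i, a_1 /\ ... /\ a_i), the a_k being the rows of A. *)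
Definition smooth_section (s : forall V, multiform V) : Prop :=
  (forall V, density_fiber (s V)) /\
  smooth_on frames (fun A =>
    oapp (fun V : Gr => let a k : taut V := vsproj (val V) (row k A) in s V a a)
         0 (insub (span_rows A))).

(* [nabla V X s] is the covariant derivative of s at V along X. *)
Definition connection
    (nabla : forall V, ((Gr -> R) -> R) -> (forall W, multiform W) ->
       multiform V) : Prop :=
  [/\ forall V X s, tangent V X -> smooth_section s ->
        density_fiber (nabla V X s),
      forall V (a : R) X Y s, tangent V X -> tangent V Y -> smooth_section s ->
        nabla V (fun f => a * X f + Y f) s =
        (fun v w => a * nabla V X s v w + nabla V Y s v w),
      forall V X s t, tangent V X -> smooth_section s -> smooth_section t ->
        nabla V X (fun W v w => s W v w + t W v w) =
        (fun v w => nabla V X s v w + nabla V X t v w),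
      forall V X f s, tangent V X -> smooth f -> smooth_section s ->
        nabla V X (fun W v w => f W * s W v w) =
        (fun v w => X f * s V v w + f V * nabla V X s v w)
    & forall xi s, smooth_vector_field xi -> smooth_section s ->
        smooth_section (fun V => nabla V (xi V) s)].

(* The map nabla s (y) does not depend on nabla when s y = 0; it is required
   to be surjective for every connection, and connections are required to
   exist so that this is not vacuous. *)
Definition defining_density (s : forall V, multiform V) (N : set Gr) : Prop :=
  [/\ smooth_section s,
      exists nabla, connection nabla
    & forall y, N y -> s y = (fun _ _ => 0) /\
        forall nabla, connection nabla ->
          forall l, density_fiber l ->
            exists X, tangent y X /\ nabla y X s = l].

Definition sigma_density (b : {symmetric 'rV[R]_n}) (V : Gr) : multiform V :=
  fun v w => \det (\matrix_(a < i, c < i) b (vsval (v a)) (vsval (w c))).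

(* b may be degenerate on W. *)
Definition has_signature (b : {symmetric 'rV[R]_n}) (W : {vspace 'rV[R]_n})
    (r s : nat) : Prop :=
  exists e : seq 'rV[R]_n,
    [/\ basis_of W e,
        {in e &, forall x y, x != y -> b x y = 0},
        count (fun x => 0 < b x x) e = r
      & count (fun x => b x x < 0) e = s].

(* By Witt's theorem this is empty or an orbit of the orthogonal group of b.
   For r + s = i - 1 it is also an orbit of the special orthogonal group, except
   when p = q = i = 1: there it consists of two points, each of them an orbit. *)
Definition signature_orbit (b : {symmetric 'rV[R]_n}) (r s : nat) : set Gr :=
  [set V | has_signature b (val V) r s].

End Grassmannian.

(* Main.v *)
From HB Require Import structures.
Require Import Defs.
From mathcomp Require Import all_boot all_order all_algebra.
From mathcomp Require Import sesquilinear fingroup perm.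
From mathcomp Require Import all_classical all_reals all_analysis.
From mathcomp Require Import ring zify.
Import Order.TTheory GRing.Theory Num.Theory.
Import numFieldNormedType.Exports.
Set Implicit Arguments.
Unset Strict Implicit.
Unset Printing Implicit Defensive.
Local Open Scope classical_set_scope.
Local Open Scope ring_scope.

(** The line bundle L = S^2(Lambda^i E^* ) has a global nowhere vanishing smooth
section, the squared volume [vol] of the standard Euclidean inner product: on a
frame A it takes the value det (A A^T), which is nonzero by positivity.  Each
fiber of L is a line ([density_fiber_rank1], because an alternating i-form on
an i-dimensional space is determined by its value on one basis), so every
section is s = f vol for a unique function f, the [coefficient] of s, and f is
smooth when s is.  This gives a connection, nabla_X (f vol) = (X f) vol.

Let now nabla be any connection and s = f vol a section vanishing at V.  The
Leibniz rule gives (nabla_X s)(V) = (X f) vol(V), so, fibers being lines,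
X |-> (nabla_X s)(V) is onto as soon as X f is nonzero for one tangent vector
X ([connection_onto]).

A frame A of a subspace V and a matrix v of the same shape define a tangent
vector at V, namely differentiation at A in the direction v of pullbacks to
frames ([tangent_frame_derivation]).  If V has signature (r, s) with
r + s = i - 1, then V has an orthogonal basis with exactly one isotropic
vector e0, the other vectors e_k being anisotropic ([orbit_frame]).  Hence the
Gram determinant, and sigma_i, vanish at V.  By nondegeneracy there is u with
b(e0, u) nonzero; subtracting projections, u may be taken orthogonal to all
other e_k ([adapted_direction]).  Moving e0 to e0 + h u then keeps the frame
orthogonal, and the Gram determinant becomes
  h (2 b(e0, u) + h b(u, u)) prod_(k != k0) b(e_k, e_k),
whose derivative at h = 0 is nonzero. *)

(** * Functions of class C^k on an open set *)

Section ClassC.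
Context (R : realType) (W : normedModType R) (U : set W).
Context (oU : open U).
Implicit Types f g : W -> R.

(** Openness of U makes agreement on U an agreement near each of its points;
this is what lets derivatives be computed from the values on U only. *)
Lemma eq_on_open f g x : (forall y, U y -> f y = g y) -> U x ->
  \near x, f x = g x.
Proof.
move=> fg Ux; near do apply: fg; exact: open_nbhs_nbhs.
Unshelve. all: by end_near. Qed.

Lemma class_C_ext k f g : (forall x, U x -> f x = g x) ->
  class_C k U f -> class_C k U g.
Proof.
elim: k f g => [|k IH] f g fg [fc fd]; split.
- move=> x Ux; apply: cvg_trans (near_eq_cvg (eq_on_open fg Ux)) _.
  by rewrite -fg //; exact: fc.
- by [].
- move=> x Ux; apply: cvg_trans (near_eq_cvg (eq_on_open fg Ux)) _.
  by rewrite -fg //; exact: fc.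
- move=> v; have [dfv Cdf] := fd v; split.
    by move=> x Ux; apply: near_eq_derivable (eq_on_open fg Ux) (dfv x Ux).
  by apply: IH Cdf => x Ux; apply: near_eq_derive; exact: eq_on_open.
Qed.

Lemma class_C_continuous k f : class_C k U f ->
  forall x, U x -> {for x, continuous f}.
Proof. by case: k => [|k] []. Qed.

Lemma class_CS k f : class_C k.+1 U f -> class_C k U f.
Proof.
elim: k f => [|k IH] f [fc fd]; split=> //= v.
by have [dfv Cdf] := fd v; split=> //; exact: IH.
Qed.

Lemma class_C_cst k (c : R) : class_C k U (fun=> c).
Proof.
elim: k c => [|k IH] c; split=> //; try by move=> x _; exact: cvg_cst.
move=> v; split; first by move=> x _; exact: derivable_cst.
by apply: class_C_ext (IH 0) => x _; rewrite (derive_cst c x v).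
Qed.

Lemma class_CD k f g : class_C k U f -> class_C k U g ->
  class_C k U (fun x => f x + g x).
Proof.
elim: k f g => [|k IH] f g [fc fd] [gc gd]; split=> //;
  try by move=> x Ux; apply: cvgD; [exact: fc|exact: gc].
move=> v; have [dfv Cdf] := fd v; have [dgv Cdg] := gd v; split.
  by move=> x Ux; apply: derivableD; [exact: dfv|exact: dgv].
apply: class_C_ext (IH _ _ Cdf Cdg) => x Ux.
by rewrite -deriveD //; [exact: dfv|exact: dgv].
Qed.

Lemma class_CM k f g : class_C k U f -> class_C k U g ->
  class_C k U (fun x => f x * g x).
Proof.
elim: k f g => [|k IH] f g Cf Cg; have [fc fd] := Cf; have [gc gd] := Cg;
  split=> //; try by move=> x Ux; apply: cvgM; [exact: fc|exact: gc].
move=> v; have [dfv Cdf] := fd v; have [dgv Cdg] := gd v; split.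
  by move=> x Ux; apply: derivableM; [exact: dfv|exact: dgv].
apply: class_C_ext (class_CD (IH _ _ (class_CS Cf) Cdg)
                             (IH _ _ (class_CS Cg) Cdf)) => x Ux.
by rewrite -deriveM //; [exact: dfv|exact: dgv].
Qed.

(** The derivative - f' / f^2 only involves f' and 1 / f with one degree of
regularity less, so the induction closes. *)
Lemma class_CV k f : (forall x, U x -> f x != 0) -> class_C k U f ->
  class_C k U (fun x => (f x)^-1).
Proof.
move=> f0; elim: k => [|k IH] Cf; have [fc fd] := Cf;
  split=> //; try by move=> x Ux; apply: cvgV; [exact: f0|exact: fc].
move=> v; have [dfv Cdf] := fd v; split.
  by move=> x Ux; apply: derivableV; [exact: f0|exact: dfv].
have Cfi := IH (class_CS Cf).
apply: class_C_ext (class_CM (class_C_cst k (-1))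
  (class_CM (class_CM Cfi Cfi) Cdf)) => x Ux.
rewrite deriveV; [|exact: f0|exact: dfv].
by rewrite mulN1r -mulNr expr2 invfM.
Qed.

Lemma smooth_on_cst (c : R) : smooth_on U (fun=> c).
Proof. by move=> k; exact: class_C_cst. Qed.

Lemma smooth_onD f g : smooth_on U f -> smooth_on U g ->
  smooth_on U (fun x => f x + g x).
Proof. by move=> Cf Cg k; exact: class_CD. Qed.

Lemma smooth_onM f g : smooth_on U f -> smooth_on U g ->
  smooth_on U (fun x => f x * g x).
Proof. by move=> Cf Cg k; exact: class_CM. Qed.

Lemma smooth_onV f : (forall x, U x -> f x != 0) -> smooth_on U f ->
  smooth_on U (fun x => (f x)^-1).
Proof. by move=> f0 Cf k; exact: class_CV. Qed.

Lemma smooth_on_ext f g : (forall x, U x -> f x = g x) ->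
  smooth_on U f -> smooth_on U g.
Proof. by move=> fg Cf k; exact: class_C_ext (Cf k). Qed.

Lemma smooth_on_sum (I : Type) (r : seq I) (P : pred I) (F : I -> W -> R) :
  (forall j, smooth_on U (F j)) ->
  smooth_on U (fun x => \sum_(j <- r | P j) F j x).
Proof.
move=> CF; elim: r => [|j r IH].
  by apply: smooth_on_ext (smooth_on_cst 0) => x _; rewrite big_nil.
have [Pj|nPj] := boolP (P j); last first.
  by apply: smooth_on_ext IH => x _; rewrite big_cons (negbTE nPj).
by apply: smooth_on_ext (smooth_onD (CF j) IH) => x _; rewrite big_cons Pj.
Qed.

Lemma smooth_on_prod (I : Type) (r : seq I) (P : pred I) (F : I -> W -> R) :
  (forall j, smooth_on U (F j)) ->
  smooth_on U (fun x => \prod_(j <- r | P j) F j x).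
Proof.
move=> CF; elim: r => [|j r IH].
  by apply: smooth_on_ext (smooth_on_cst 1) => x _; rewrite big_nil.
have [Pj|nPj] := boolP (P j); last first.
  by apply: smooth_on_ext IH => x _; rewrite big_cons (negbTE nPj).
by apply: smooth_on_ext (smooth_onM (CF j) IH) => x _; rewrite big_cons Pj.
Qed.

(** The Leibniz formula is a polynomial in the entries. *)
Lemma smooth_on_det m (F : W -> 'M[R]_m) :
  (forall a c, smooth_on U (fun x => F x a c)) ->
  smooth_on U (fun x => \det (F x)).
Proof.
move=> CF; apply: smooth_on_sum => s; apply: smooth_onM.
  exact: smooth_on_cst.
by apply: smooth_on_prod => a; exact: CF.
Qed.

End ClassC.

(** By linearity the difference quotient of an entry is constant. *)
Lemma entry_difference_quotient_cvg (R : realType) m n k j (A v : 'M[R]_(m, n)) :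
  h^-1 *: (((fun M : 'M[R]_(m, n) => M k j) \o shift A) (h *: v) - A k j)
    @[h --> 0^'] --> v k j.
Proof.
apply: cvg_near_cst.
near=> h; rewrite /= !mxE addrK /GRing.scale /= mulKf //.
near: h; exact: nbhs_dnbhs_neq.
Unshelve. all: by end_near. Qed.

Lemma smooth_on_entry (R : realType) m n (U : set 'M[R]_(m, n)) k j :
  open U -> smooth_on U (fun A => A k j).
Proof.
move=> oU [|l]; split=> //; try by move=> A _; exact: coord_continuous.
move=> v; have D A := @entry_difference_quotient_cvg R m n k j A v.
split; first by move=> A _; apply/cvg_ex; exists (v k j); exact: D.
apply: class_C_ext (class_C_cst oU l (v k j)) => // A _.
by apply/esym/cvg_lim; [exact: Rhausdorff|exact: D].
Qed.

(** * Alternating forms in top degree *)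

Section Alternating.
Context (R : realType) (i : nat) (U : vectType R).
Implicit Types (w : ('I_i -> U) -> R) (v e : 'I_i -> U).

Lemma dfwithE v k x a : dfwith v k x a = if a == k then x else v a.
Proof.
by have [->|ak] := eqVneq a k; [rewrite dfwithin|rewrite dfwithout // eq_sym].
Qed.

Lemma alternatingD w v k x y : alternating_form w ->
  w (dfwith v k (x + y)) = w (dfwith v k x) + w (dfwith v k y).
Proof. by case=> lw _; rewrite -[in LHS](scale1r x) lw mul1r. Qed.

Lemma alternating_sum w v k (J : Type) (r : seq J) (x : J -> R) (u : J -> U) :
  alternating_form w ->
  w (dfwith v k (\sum_(c <- r) x c *: u c)) =
  \sum_(c <- r) x c * w (dfwith v k (u c)).
Proof.
case=> lw _; elim: r => [|c r IH]; last by rewrite !big_cons lw IH.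
rewrite !big_nil; have := lw v k (-1) 0 0.
by rewrite scaleN1r oppr0 addr0 mulN1r addNr.
Qed.

(** Polarize: expand the vanishing value obtained by putting [v j + v k] in both
slots. *)
Lemma alternating_swap w v j k : alternating_form w -> j != k ->
  w (v \o tperm j k) = - w v.
Proof.
move=> aw jk; have [_ aw0] := aw.
pose D x y := w (dfwith (dfwith v j x) k y).
have D0 x : D x x = 0.
  by apply: (aw0 _ j k) => //; rewrite !dfwithE !eqxx (negbTE jk).
have Dl x x' y : D (x + x') y = D x y + D x' y.
  have sw z : dfwith (dfwith v j z) k y = dfwith (dfwith v k y) j z.
    apply/funext => a; rewrite !dfwithE.
    by have [->|//] := eqVneq a k; rewrite eq_sym (negbTE jk).
  by rewrite /D !sw alternatingD.
have Dr x y y' : D x (y + y') = D x y + D x y' by rewrite /D alternatingD.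
have -> : w v = D (v j) (v k).
  congr w; apply/funext => a; rewrite !dfwithE.
  by have [->//|] := eqVneq a k; have [->|] := eqVneq a j.
have -> : w (v \o tperm j k) = D (v k) (v j).
  congr w; apply/funext => a; rewrite !dfwithE /=.
  by case: tpermP => [->|->|/eqP/negbTE -> /eqP/negbTE ->//];
    rewrite ?eqxx ?(negbTE jk).
apply/eqP; rewrite -addr_eq0; apply/eqP.
by have := D0 (v k + v j); rewrite Dl !Dr !D0 add0r addr0.
Qed.

(** Uniqueness of the volume form, in a form free of divisions and of
determinants.  Both sides expand by multilinearity over tuples of vectors of e;
a tuple with a repetition contributes zero to both, and one that permutes e is
sorted by transpositions, each of which negates both sides. *)
Lemma alternating_unique w1 w2 e v :
    alternating_form w1 -> alternating_form w2 ->
    (forall a, exists x : 'I_i -> R, v a = \sum_c x c *: e c) ->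
  w1 v * w2 e = w2 v * w1 e.
Proof.
move=> aw1 aw2.
have perm_case (s : {perm 'I_i}) : w1 (e \o s) * w2 e = w2 (e \o s) * w1 e.
  have [ts -> /=] := prod_tpermP s.
  elim: ts => [|[j k] ts IH] /=.
    move=> _; rewrite big_nil; suff -> : e \o (1%g : {perm 'I_i}) = e.
      by rewrite mulrC.
    by apply/funext => a /=; rewrite perm1.
  case/andP=> /= jk /IH {}IH; rewrite big_cons /=.
  set s' := (\prod_(_ <- _) _)%g in IH *.
  have -> : e \o (tperm j k * s')%g = (e \o s') \o tperm j k.
    by apply/funext => a /=; rewrite permM.
  by rewrite !alternating_swap // !mulNr IH.
have map_case (f : 'I_i -> 'I_i) : w1 (e \o f) * w2 e = w2 (e \o f) * w1 e.
  have [injf|/injectivePn[j [k jk fjk]]] := boolP (injectiveb f).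
    rewrite (_ : e \o f = e \o perm (injectiveP f injf)) //.
    by apply/funext => a /=; rewrite permE.
  have efjk : (e \o f) j = (e \o f) k by rewrite /= fjk.
  by rewrite (proj2 aw1 _ _ _ jk efjk) (proj2 aw2 _ _ _ jk efjk) !mul0r.
(* The slots are expanded one at a time: those from m on are already in e. *)
suff gen (m : nat) v' : (forall a, exists x : 'I_i -> R, v' a = \sum_c x c *: e c) ->
    (forall a : 'I_i, (m <= a)%N -> exists c, v' a = e c) ->
    w1 v' * w2 e = w2 v' * w1 e.
  by move=> ve; apply: (gen i) => // a; rewrite leqNgt ltn_ord.
elim: m v' => [|m IH] v' ve vm.
  have [f fE] := choice (fun a => vm a isT).
  by rewrite (_ : v' = e \o f) //; apply/funext.
have [im|mi] := leqP i m.
  by apply: IH => // a ma; have := ltn_ord a; rewrite ltnNge (leq_trans im ma).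
pose k := Ordinal mi; have [x xE] := ve k.
have -> : v' = dfwith v' k (\sum_c x c *: e c).
  by apply/funext => a; rewrite dfwithE; case: eqVneq => // ->.
rewrite !alternating_sum // !mulr_suml; apply: eq_bigr => c _.
rewrite -!mulrA; congr (_ * _); apply: IH => a.
  rewrite dfwithE; case: eqVneq => // _; exists (fun c' => (c' == c)%:R).
  rewrite (bigD1 c) //= eqxx scale1r big1 ?addr0 // => c' /negbTE ->.
  by rewrite scale0r.
rewrite dfwithE; case: eqVneq => [_ _|ak ma]; first by exists c.
by apply: vm; rewrite ltn_neqAle ma andbT; apply: contra ak => /eqP ma';
  apply/eqP/val_inj.
Qed.

End Alternating.

(** * Frames of subspaces *)

Section Frames.
Context (R : realType) (i n : nat).
Implicit Types (A : 'M[R]_(i, n)) (V : Gr R i n).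

Lemma span_rowsE A : span_rows A = <<[tuple row k A | k < i]>>%VS.
Proof. by []. Qed.

Lemma row_in_span A k : row k A \in span_rows A.
Proof. by apply: memv_span; apply: map_f; rewrite mem_enum. Qed.

Lemma span_rows_coord A x : x \in span_rows A ->
  exists y : 'I_i -> R, x = \sum_c y c *: row c A.
Proof.
rewrite span_rowsE => /coord_span xE.
exists (fun c => coord [tuple row k A | k < i] c x); rewrite {1}xE.
by apply: eq_bigr => c _; rewrite -tnth_nth tnth_mktuple.
Qed.

(** Row freeness is a statement on matrices, freeness one on families in a vector
space; they agree since the combinations of the rows of A are the products y A. *)
Lemma row_free_span A : row_free A = free [tuple row k A | k < i].
Proof.
have E (y : 'rV[R]_i) :
    \sum_c y 0 c *: [tuple row k A | k < i]`_c = y *m A.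
  by rewrite mulmx_sum_row; apply: eq_bigr => c _; rewrite -tnth_nth tnth_mktuple.
apply/idP/freeP => [fA y y0 c|fA].
  have := E (\row_c y c); under eq_bigr do rewrite mxE; rewrite y0 => /esym/eqP.
  by rewrite mulmx_free_eq0 // => /eqP/rowP/(_ c); rewrite !mxE.
apply: inj_row_free => y yA; apply/rowP => c; rewrite mxE.
by apply: (fA (fun c => y 0 c)); rewrite E.
Qed.

Lemma dim_span_rows A : row_free A -> \dim (span_rows A) == i.
Proof. by rewrite row_free_span span_rowsE => /eqP ->; rewrite size_tuple. Qed.

Definition Gr_span A (fA : row_free A) : Gr R i n :=
  exist _ (span_rows A) (dim_span_rows fA).

Lemma insub_span V A : span_rows A = val V -> insub (span_rows A) = Some V.
Proof. by move=> ->; rewrite valK. Qed.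

Lemma row_free_of_span V A : span_rows A = val V -> row_free A.
Proof.
move=> AV; rewrite row_free_span /free -span_rowsE AV size_tuple.
exact: (valP V).
Qed.

Lemma exists_frame V : exists A, span_rows A = val V.
Proof.
exists (\matrix_(k < i) (vbasis (val V))`_k).
rewrite -[RHS](span_basis (vbasisP (val V))) /span_rows; congr (<<_>>)%VS.
apply: (@eq_from_nth _ 0).
  by rewrite size_map -cardE card_ord size_tuple; exact/esym/eqP/(valP V).
move=> j; rewrite size_map -cardE card_ord => ji.
by rewrite (nth_map (Ordinal ji)) -?cardE ?card_ord // rowK nth_enum_ord.
Qed.

Definition frame_of V : 'M[R]_(i, n) := projT1 (cid (exists_frame V)).

Lemma span_frame_of V : span_rows (frame_of V) = val V.
Proof. exact: projT2 (cid (exists_frame V)). Qed.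

Definition rows_in V A : 'I_i -> taut V := fun k => vsproj (val V) (row k A).

Lemma rows_inE V A k : span_rows A = val V -> vsval (rows_in V A k) = row k A.
Proof. by move=> AV; rewrite vsprojK // -AV row_in_span. Qed.

(** The fibers of L are lines, spanned by any C that is nonzero on a frame: the
uniqueness of alternating forms, applied to each half of the arguments in turn,
links both sides to the mixed product of C v a and B a w. *)
Lemma density_fiber_rank1 V A (B C : multiform V) v w :
    span_rows A = val V -> density_fiber B -> density_fiber C ->
  let a := rows_in V A in B v w * C a a = C v w * B a a.
Proof.
move=> AV [B1 B2 Bs] [C1 C2 Cs] a.
have sp (u : 'I_i -> taut V) j :
    exists x : 'I_i -> R, u j = \sum_c x c *: a c.
  have [|x xE] := @span_rows_coord A (vsval (u j)); first by rewrite AV subvsP.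
  exists x; apply: val_inj; rewrite /= xE linear_sum /=; apply: eq_bigr => c _.
  by rewrite rows_inE.
have h1 := alternating_unique (B1 w) (C1 a) (sp v).
have h2 := alternating_unique (B2 a) (C2 v) (sp w).
by rewrite h1 mulrC h2.
Qed.
End Frames.

(** * The Euclidean inner product *)

Section Dot.
Context (R : realType) (n : nat).

Definition dotp (x y : 'rV[R]_n) : R := (x *m y^T) 0 0.

Lemma dotp_bilinear : bilinear_for ( *%R ) ( *%R ) dotp.
Proof.
split=> [y a x x'|x a y y']; rewrite /dotp.
  by rewrite mulmxDl -scalemxAl !mxE.
by rewrite linearP /= mulmxDr -scalemxAr !mxE.
Qed.

HB.instance Definition _ := bilinear_isBilinear.Build R 'rV[R]_n 'rV[R]_n R
  ( *%R ) ( *%R ) dotp dotp_bilinear.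

Lemma dotp_sym x y : dotp x y = (-1) ^+ false * idfun (dotp y x).
Proof. by rewrite expr0 mul1r /dotp /= -[x]trmxK -trmx_mul trmxK mxE. Qed.

HB.instance Definition _ := isHermitianSesquilinear.Build R 'rV[R]_n false idfun
  dotp dotp_sym.
Definition dot : {symmetric 'rV[R]_n} := dotp.
End Dot.

(** * Gram determinants *)

Section Gram.
Context (R : realType) (i n : nat).
Implicit Types (A : 'M[R]_(i, n)) (V : Gr R i n) (b : {symmetric 'rV[R]_n}).

Definition gram b A : 'M[R]_i := \matrix_(a, c) b (row a A) (row c A).

Lemma symmetricC b x y : b x y = b y x.
Proof. by rewrite (hermC b) expr0 mul1r. Qed.

(** In coordinates the Gram matrix is quadratic in the entries of A. *)
Lemma smooth_on_gram (U : set 'M[R]_(i, n)) b : open U ->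
  smooth_on U (fun A => \det (gram b A)).
Proof.
move=> oU; apply: smooth_on_det => // a c.
apply: (@smooth_on_ext _ _ _ oU (fun A : 'M[R]_(i, n) =>
   \sum_j A a j * \sum_l A c l * b 'e_j 'e_l)).
  move=> A _; rewrite mxE [row a A]row_sum_delta [row c A]row_sum_delta.
  rewrite linear_sumlz; apply: eq_bigr => j _.
  rewrite linearZl_LR /= !mxE; congr (_ * _); rewrite linear_sumr.
  by apply: eq_bigr => l _; rewrite linearZr /= mxE.
apply: smooth_on_sum => // j; apply: smooth_onM => //; first exact: smooth_on_entry.
apply: smooth_on_sum => // l; apply: smooth_onM => //; first exact: smooth_on_entry.
exact: smooth_on_cst.
Qed.

(** In the trivialization given by a frame, sigma is the Gram determinant. *)
Lemma sigma_density_rows b V A : span_rows A = val V ->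
  sigma_density b (rows_in V A) (rows_in V A) = \det (gram b A).
Proof.
move=> AV; rewrite /sigma_density; congr (\det _); apply/matrixP => a c.
by rewrite [RHS]mxE mxE !rows_inE.
Qed.

Lemma gram_dot A : gram (dot R n) A = A *m A^T.
Proof.
apply/matrixP => a c; rewrite !mxE (_ : dot R n _ _ = (row a A *m (row c A)^T) 0 0) // mxE.
by apply: eq_bigr => l _; rewrite !mxE.
Qed.

(** A vector x killed by A A^T satisfies |x A|^2 = 0, hence x A = 0 by
positivity of sums of squares in R. *)
Lemma det_gram_dot A : (\det (gram (dot R n) A) != 0) = row_free A.
Proof.
rewrite gram_dot -unitfE -unitmxE -row_free_unit.
apply/idP/idP => [fA|fA]; apply: inj_row_free => x.
  by move=> xA; apply/eqP; rewrite -(mulmx_free_eq0 _ fA) mulmxA xA mul0mx.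
move=> /(congr1 (mulmxr x^T)) /=; rewrite mul0mx mulmxA -mulmxA -trmx_mul.
move=> /matrixP/(_ 0 0); rewrite !mxE => /eqP.
rewrite psumr_eq0 => [/allP x0|j _]; last by rewrite [X in _ * X]mxE -expr2 sqr_ge0.
apply/eqP; rewrite -(mulmx_free_eq0 _ fA); apply/eqP/rowP => j.
have := x0 j (mem_index_enum j); rewrite [X in _ * X]mxE /= mulf_eq0 orbb [RHS]mxE.
by move=> /eqP.
Qed.

(** Frames are the matrices with nonzero Euclidean Gram determinant. *)
Lemma open_frames : open (@frames R i n).
Proof.
have -> : @frames R i n = (fun A => \det (gram (dot R n) A)) @^-1` [set x | x != 0].
  by apply/seteqP; split=> A /=; rewrite det_gram_dot.
apply: open_comp; last exact: open_neq.
move=> A _; exact: (class_C_continuous (smooth_on_gram (dot R n) openT 0)).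
Qed.

(** Multilinearity and alternation in the first half are those of the determinant
in its rows; the second half follows by transposition, b being symmetric. *)
Lemma sigma_density_fiber b V : density_fiber (@sigma_density R i n b V).
Proof.
have sym v w : @sigma_density R i n b V v w = sigma_density b w v.
  rewrite /sigma_density -det_tr; congr (\det _); apply/matrixP => a c.
  by rewrite !mxE symmetricC.
have alt w : alternating_form ((@sigma_density R i n b V)^~ w).
  split=> [v k a x y|v j k jk vjk].
    rewrite -(mul1r (sigma_density b (dfwith v k y) w)).
    apply: (determinant_multilinear (i0 := k)).
    - apply/rowP => c; rewrite !mxE !dfwithE eqxx mul1r.
      by rewrite linearPl.
    - by apply/matrixP => j c; rewrite !mxE !dfwithE eq_sym (negbTE (neq_lift _ _)).
    - by apply/matrixP => j c; rewrite !mxE !dfwithE eq_sym (negbTE (neq_lift _ _)).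
  apply: (determinant_alternate jk) => c.
  by rewrite !mxE vjk.
split=> // v; have := alt v; congr alternating_form; apply/funext => w.
by rewrite sym.
Qed.

End Gram.

(** * Functions and sections on the Grassmannian *)

Section Functions.
Context (R : realType) (i n : nat).
Implicit Types (A : 'M[R]_(i, n)) (V : Gr R i n) (f g : Gr R i n -> R).
Implicit Types (s t : forall V : Gr R i n, multiform V).

Definition pullback f A : R := oapp f 0 (insub (span_rows A)).

Lemma pullbackE f V A : span_rows A = val V -> pullback f A = f V.
Proof. by move=> AV; rewrite /pullback (insub_span AV). Qed.

Lemma pullback_frame f A (fA : row_free A) : pullback f A = f (Gr_span fA).
Proof. exact: (@pullbackE _ (Gr_span fA)). Qed.

Let oF : open (@frames R i n). Proof. exact: open_frames. Qed.

Lemma smooth_cst (c : R) : smooth (fun _ : Gr R i n => c).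
Proof.
apply: smooth_on_ext (smooth_on_cst oF c) => // A fA.
by rewrite -/(pullback _ A) pullback_frame.
Qed.

Lemma smoothD f g : smooth f -> smooth g -> smooth (fun V => f V + g V).
Proof.
move=> sf sg; apply: smooth_on_ext (smooth_onD oF sf sg) => // A fA.
by rewrite -!/(pullback _ A) !(pullback_frame _ fA).
Qed.

Lemma smoothM f g : smooth f -> smooth g -> smooth (fun V => f V * g V).
Proof.
move=> sf sg; apply: smooth_on_ext (smooth_onM oF sf sg) => // A fA.
by rewrite -!/(pullback _ A) !(pullback_frame _ fA).
Qed.

(** The image under the differential of [span_rows] at A of the direction v, as a
derivation; the value 0 on nonsmooth functions follows the convention for
tangent vectors. *)
Definition frame_derivation A (v : 'M[R]_(i, n)) : (Gr R i n -> R) -> R :=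
  fun f => if `[< smooth f >] then 'D_v (pullback f) A else 0.

Lemma frame_derivation_smooth A v f :
  smooth f -> frame_derivation A v f = 'D_v (pullback f) A.
Proof. by move=> sf; rewrite /frame_derivation asboolT. Qed.

Lemma smooth_derivable f A v : smooth f -> row_free A ->
  derivable (pullback f) A v.
Proof. by move=> sf fA; have [_ /(_ v)[+ _]] := sf 1%N; apply. Qed.

Lemma near_frames A (f g : 'M[R]_(i, n) -> R) : row_free A ->
  (forall B, row_free B -> f B = g B) -> \near A, f A = g A.
Proof. by move=> fA fg; apply: (eq_on_open oF). Qed.

(** Pullback is a ring morphism at the frames, which are open, so additivity and
the Leibniz rule are inherited from directional derivatives. *)
Lemma tangent_frame_derivation V A v : span_rows A = val V ->
  tangent V (frame_derivation A v).
Proof.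
move=> AV; have fA := row_free_of_span AV.
split=> [a f g sf sg|f g sf sg|f nf]; last by rewrite /frame_derivation asboolF.
  have saf : smooth (fun W => a * f W) by apply: smoothM => //; exact: smooth_cst.
  rewrite !frame_derivation_smooth //; last exact: smoothD.
  have df := smooth_derivable (v := v) sf fA; have dg := smooth_derivable (v := v) sg fA.
  rewrite -deriveMl // -deriveD //; last exact: (derivableM (derivable_cst a A v)).
  apply: near_eq_derive; apply: (near_frames fA) => B fB.
  by rewrite fctE /= !(pullback_frame _ fB).
rewrite !frame_derivation_smooth //; last exact: smoothM.
have df := smooth_derivable (v := v) sf fA; have dg := smooth_derivable (v := v) sg fA.
transitivity ('D_v (pullback f * pullback g) A).
  apply: near_eq_derive; apply: (near_frames fA) => B fB.
  by rewrite fctE !(pullback_frame _ fB).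
rewrite deriveM // !(pullbackE _ AV) /GRing.scale /=; ring.
Qed.

Lemma tangentZ V (c : R) X : tangent V X -> tangent V (fun f => c * X f).
Proof.
case=> lX dX nX; split=> [a f g sf sg|f g sf sg|f nf].
- by rewrite lX //; ring.
- by rewrite dX //; ring.
- by rewrite nX // mulr0.
Qed.

Lemma density_fiberZ V (c : R) (B : multiform V) : density_fiber B ->
  density_fiber (fun v w => c * B v w).
Proof.
case=> B1 B2 Bs.
split=> [w|v|v w]; last by rewrite Bs.
- have [l a] := B1 w; split=> [v k x y z|v j k jk e].
    by rewrite l; ring.
  by rewrite (a _ _ _ jk e) mulr0.
- have [l a] := B2 v; split=> [w k x y z|w j k jk e].
    by rewrite l; ring.
  by rewrite (a _ _ _ jk e) mulr0.
Qed.

Notation vol := (sigma_density (dot R n)).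

Lemma smooth_sigma_density (b : {symmetric 'rV[R]_n}) :
  smooth_section (@sigma_density R i n b).
Proof.
split=> [V|]; first exact: sigma_density_fiber.
apply: smooth_on_ext (smooth_on_gram b oF) => // A fA.
by rewrite (@insub_span _ _ _ (Gr_span fA)) //= -(@sigma_density_rows _ _ _ _ (Gr_span fA)).
Qed.

Lemma smooth_sectionZ f s : smooth f -> smooth_section s ->
  smooth_section (fun V v w => f V * s V v w).
Proof.
move=> sf [ds ss]; split=> [V|]; first exact: density_fiberZ.
apply: smooth_on_ext (smooth_onM oF sf ss) => // A fA.
by rewrite !(@insub_span _ _ _ (Gr_span fA)).
Qed.

(** The function f with s = f vol, for the squared Euclidean volume vol; when s
takes values in L, the quotient does not depend on the chosen frame
([coefficient_rows]). *)
Definition coefficient s V : R :=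
  let a := rows_in V (frame_of V) in s V a a / vol a a.

Lemma vol_rows_neq0 V A : span_rows A = val V ->
  vol (rows_in V A) (rows_in V A) != 0.
Proof.
move=> AV; rewrite sigma_density_rows // det_gram_dot.
exact: row_free_of_span AV.
Qed.

Lemma coefficientE s V : density_fiber (s V) ->
  s V = fun v w => coefficient s V * vol v w.
Proof.
move=> ds; apply/funext => v; apply/funext => w; rewrite /coefficient.
have AV := span_frame_of V; have v0 := vol_rows_neq0 AV.
have := density_fiber_rank1 v w AV ds (sigma_density_fiber (dot R n) V).
by move=> /= E; apply: (mulIf v0); rewrite E mulrAC divfK // mulrC.
Qed.

Lemma coefficient_rows s V A : density_fiber (s V) -> span_rows A = val V ->
  coefficient s V = s V (rows_in V A) (rows_in V A) / \det (gram (dot R n) A).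
Proof.
move=> ds AV; rewrite -(sigma_density_rows _ AV) // [in RHS]coefficientE //.
by rewrite mulfK //; exact: vol_rows_neq0.
Qed.

(** On frames the coefficient is the quotient of the trivialized section by the
nowhere vanishing polynomial det (A A^T). *)
Lemma smooth_coefficient s : smooth_section s -> smooth (coefficient s).
Proof.
case=> ds ss.
have iv : smooth_on (@frames R i n) (fun A => (\det (gram (dot R n) A))^-1).
  apply: smooth_onV => //; last exact: smooth_on_gram.
  by move=> A fA; rewrite det_gram_dot.
apply: smooth_on_ext (smooth_onM oF ss iv) => // A fA.
rewrite !(@insub_span _ _ _ (Gr_span fA)) //=.
by rewrite (@coefficient_rows _ _ A).
Qed.

(** The flat connection for which the global section vol is parallel. *)
Definition vol_connection V (X : (Gr R i n -> R) -> R) s : multiform V :=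
  fun v w => X (coefficient s) * vol v w.

Lemma vol_connectionP : connection vol_connection.
Proof.
split.
- move=> V X s _ _; apply: density_fiberZ; exact: sigma_density_fiber.
- move=> V a X Y s _ _ _; apply/funext => v; apply/funext => w.
  by rewrite /vol_connection; ring.
- move=> V X s t [lX _ _] ss st; apply/funext => v; apply/funext => w.
  rewrite /vol_connection -mulrDl; congr (_ * _).
  rewrite -[X in _ = X + _]mul1r -lX; try exact: smooth_coefficient.
  by congr X; apply/funext => W; rewrite /coefficient mulrDl mul1r.
- move=> V X f s [_ dX _] sf ss; apply/funext => v; apply/funext => w.
  have cs : s V v w = coefficient s V * vol v w.
    by rewrite {1}coefficientE //; case: ss.
  rewrite /vol_connection cs (mulrA (X f)) (mulrA (f V)) -mulrDl.
  congr (_ * _); rewrite -dX //; last exact: smooth_coefficient.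
  by congr X; apply/funext => W; rewrite /coefficient mulrA.
- move=> xi s [_ sxi] ss; apply: smooth_sectionZ.
    by apply: sxi; exact: smooth_coefficient.
  exact: smooth_sigma_density.
Qed.

(** Writing s = f vol with f(V) = 0, the Leibniz rule leaves only (X f) vol(V):
at a zero of s all connections agree. *)
Lemma connection_at_zero (nabla : forall V, ((Gr R i n -> R) -> R) ->
       (forall W, multiform W) -> multiform V) V X s :
  connection nabla -> tangent V X -> smooth_section s -> s V = (fun _ _ => 0) ->
  nabla V X s = fun v w => X (coefficient s) * vol v w.
Proof.
move=> [_ _ _ leib _] tX ss s0.
have sE : s = fun W v w => coefficient s W * vol v w.
  by apply: functional_extensionality_dep => W; apply: coefficientE; case: ss.
have c0 : coefficient s V = 0 by rewrite /coefficient s0 mul0r.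
rewrite {1}sE leib //; [|exact: smooth_coefficient|exact: smooth_sigma_density].
by apply/funext => v; apply/funext => w; rewrite c0 mul0r addr0.
Qed.

(** The image is a nonzero subspace of a line: a target l is reached by rescaling X,
the space of tangent vectors being stable under scalars. *)
Lemma connection_onto nabla V X s :
  connection nabla -> tangent V X -> smooth_section s -> s V = (fun _ _ => 0) ->
  X (coefficient s) != 0 ->
  forall l, density_fiber l -> exists Y, tangent V Y /\ nabla V Y s = l.
Proof.
move=> cn tX ss s0 X0 l dl.
have [A AV] := exists_frame V.
pose a := rows_in V A; have v0 : vol a a != 0 := vol_rows_neq0 AV.
pose c := l a a / vol a a.
exists (fun f => (c / X (coefficient s)) * X f); split; first exact: tangentZ.
rewrite connection_at_zero //; last exact: tangentZ.
apply/funext => v; apply/funext => w; rewrite divfK //; apply: (mulIf v0).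
rewrite (density_fiber_rank1 v w AV dl (sigma_density_fiber (dot R n) V)).
by rewrite /c mulrAC divfK // mulrC.
Qed.
End Functions.

(** * The orbits with r + s = i - 1 *)

Section Orbit.
Context (R : realType) (i n : nat) (b : {symmetric 'rV[R]_n}).
Implicit Types (A : 'M[R]_(i, n)) (V : Gr R i n).

(** A frame diagonalizing b with a single zero on the diagonal, at k0. *)
Definition corank1_frame A (k0 : 'I_i) :=
  [/\ row_free A, forall k l, k != l -> b (row k A) (row l A) = 0,
      b (row k0 A) (row k0 A) = 0
    & forall k, k != k0 -> b (row k A) (row k A) != 0].

Lemma count_signs (e : seq 'rV[R]_n) :
  (count (fun x => (0 < b x x)%R) e + count (fun x => (b x x < 0)%R) e +
   count (fun x => (b x x == 0)%R) e = size e)%N.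
Proof.
elim: e => //= x e <-; case: (ltgtP 0 (b x x)) => _ /=; lia.
Qed.

(** Among the i vectors of an orthogonal basis of V, r are positive and s are
negative; as r + s = i - 1, exactly one is isotropic. *)
Lemma orbit_frame V r s : (0 < i)%N -> (r + s = i - 1)%N ->
  signature_orbit b r s V ->
  exists A k0, span_rows A = val V /\ corank1_frame A k0.
Proof.
move=> i0 rs [e [be oe er es]].
have se : size e = i by rewrite -(eqP (basis_free be)) (span_basis be); exact/eqP/(valP V).
have fe := basis_free be; have ue := free_uniq fe.
have z1 : count (fun x => b x x == 0) e = 1%N.
  have := count_signs e; rewrite er es se; lia.
have /hasP[x0 xe /eqP bx0] : has (fun x => b x x == 0) e by rewrite has_count z1.
(* The isotropic vector is unique, so the others are anisotropic. *)
have only x : x \in e -> b x x = 0 -> x = x0.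
  move=> xe' bx; apply/eqP; move: z1; rewrite -size_filter => /eqP.
  case F : [seq y <- e | b y y == 0] => [|y [|? ?]] // _.
  have : x \in [:: y] by rewrite -F mem_filter bx eqxx.
  have : x0 \in [:: y] by rewrite -F mem_filter bx0 eqxx.
  by rewrite !inE => /eqP -> /eqP ->.
have k0i : (index x0 e < i)%N by rewrite -se index_mem.
pose A : 'M[R]_(i, n) := \matrix_(k < i) e`_k; pose k0 := Ordinal k0i.
have rA k : row k A = e`_k by rewrite rowK.
have ke (k : 'I_i) : e`_k \in e by rewrite mem_nth ?se.
have rk0 : row k0 A = x0 by rewrite rA /= nth_index.
have AV : span_rows A = val V.
  rewrite -(span_basis be) /span_rows; congr (<<_>>)%VS.
  apply: (@eq_from_nth _ 0); first by rewrite size_map -cardE card_ord se.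
  move=> j; rewrite size_map -cardE card_ord => ji.
  by rewrite (nth_map (Ordinal ji)) -?cardE ?card_ord // rA nth_enum_ord.
exists A, k0; split=> //; split; first exact: row_free_of_span AV.
- by move=> k l kl; rewrite !rA oe // nth_uniq ?se.
- by rewrite rk0.
- move=> k; apply: contra; rewrite rA => /eqP /(only _ (ke k)) kx0.
  by apply/eqP/val_inj; rewrite /= -kx0 index_uniq ?se.
Qed.

Lemma gram_corank1 A k0 : corank1_frame A k0 -> \det (gram b A) = 0.
Proof.
case=> _ oA A0 _.
have -> : gram b A = diag_mx (\row_k b (row k A) (row k A)).
  apply/matrixP => k l; rewrite !mxE; case: eqVneq => [->|kl].
    by rewrite mulr1n.
  by rewrite mulr0n oA.
by rewrite det_diag (bigD1 k0) //= mxE A0 mul0r.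
Qed.

(** Nondegeneracy gives u0 not orthogonal to the isotropic row.  The other rows
are anisotropic, so their components can be projected out of u0; they are
orthogonal to the isotropic row, whose pairing with u0 is thus unchanged. *)
Lemma adapted_direction A k0 : nondegenerate b -> corank1_frame A k0 ->
  exists u, b (row k0 A) u != 0 /\ forall k, k != k0 -> b (row k A) u = 0.
Proof.
move=> nb [fA oA A0 An].
have r0 : row k0 A != 0.
  have := free_not0 (etrans (esym (row_free_span A)) fA); apply.
  by rewrite -(tnth_mktuple (fun k => row k A) k0) mem_tnth.
have /mem_orthovPn[u0 _ bu0] : row k0 A \notin orthov b fullv.
  by move: nb => /eqP ->; rewrite memv0.
pose u := u0 - \sum_(l | l != k0) (b (row l A) u0 / b (row l A) (row l A)) *: row l A.
have bu k : b (row k A) u = b (row k A) u0 -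
    \sum_(l | l != k0) b (row l A) u0 / b (row l A) (row l A) * b (row k A) (row l A).
  rewrite linearBr linear_sumr; congr (_ - _); apply: eq_bigr => l _.
  by rewrite linearZr.
exists u; split; first rewrite bu big1 ?subr0 // => l lk.
  by rewrite (oA k0 l) ?mulr0 // eq_sym.
move=> k kk0; rewrite bu (bigD1 k) //= big1 => [|l /andP[_ lk]].
  by rewrite addr0 divfK ?subrr //; exact: An.
by rewrite (oA k l) ?mulr0 // eq_sym.
Qed.

(** The rows stay pairwise orthogonal along the line, so the Gram matrix stays
diagonal; only its entry at k0 moves, from 0 to 2 h b(a, u) + h^2 b(u, u), where
a is the isotropic row. *)
Lemma gram_line A k0 u (h : R) : corank1_frame A k0 ->
    (forall k, k != k0 -> b (row k A) u = 0) ->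
  \det (gram b (h *: (\matrix_k if k == k0 then u else 0) + A)) =
  h * ((2 * b (row k0 A) u + h * b u u) *
       \prod_(k | k != k0) b (row k A) (row k A)).
Proof.
case=> _ oA A0 _ ou; set v := \matrix_k _.
pose d k := if k == k0 then h * (2 * b (row k0 A) u + h * b u u)
            else b (row k A) (row k A).
have rv k : row k (h *: v + A) = (if k == k0 then h *: u + row k A else row k A).
  rewrite linearD linearZ /= rowK; case: eqP => // _.
  by rewrite scaler0 add0r.
have -> : gram b (h *: v + A) = diag_mx (\row_k d k).
  apply/matrixP => k l; rewrite [LHS]mxE !rv !mxE /d.
  case: (eqVneq k l) => [<-|kl]; rewrite ?mulr1n ?mulr0n.
    case: (eqVneq k k0) => // ->.
    rewrite linearDl !linearDr !linearZr !linearZl_LR /= A0 (symmetricC b u (row _ _)).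
    by rewrite !linearZr /GRing.scale /=; ring.
  case: (eqVneq k k0) => [kk|kk]; case: (eqVneq l k0) => [lk|lk].
  - by rewrite kk lk eqxx in kl.
  - by rewrite linearDl linearZl_LR /= oA // symmetricC ou // mulr0 addr0.
  - by rewrite linearDr linearZr /= oA // ou // mulr0 addr0.
  - by rewrite oA.
rewrite det_diag (bigD1 k0) //= mxE /d eqxx -mulrA; congr (_ * (_ * _)).
by apply: eq_bigr => k /negbTE kk; rewrite mxE kk.
Qed.

Lemma derive_line (W : normedModType R) (f : W -> R) x v (g : R -> R) :
  {for 0, continuous g} -> (forall h, f (h *: v + x) = f x + h * g h) ->
  'D_v f x = g 0.
Proof.
move=> cg fE; apply: cvg_lim; first exact: Rhausdorff.
have g0 : g h @[h --> 0^'] --> g 0 by exact: cvg_within_filter.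
apply: cvg_trans g0; apply: near_eq_cvg; near=> h.
rewrite /= fE addrAC subrr add0r /GRing.scale /= mulKf //.
near: h; exact: nbhs_dnbhs_neq.
Unshelve. all: by end_near. Qed.

(** The coefficient of sigma is the Gram determinant of b times the inverse of the
Euclidean one.  The first factor vanishes at A, so only its derivative matters,
and [gram_line] gives that derivative. *)
Lemma coefficient_derivation A k0 V u : span_rows A = val V -> corank1_frame A k0 ->
    b (row k0 A) u != 0 -> (forall k, k != k0 -> b (row k A) u = 0) ->
  frame_derivation A (\matrix_k if k == k0 then u else 0)
    (coefficient (@sigma_density R i n b)) != 0.
Proof.
move=> AV cA bu ou; have [fA oA A0 An] := cA.
rewrite frame_derivation_smooth; last first.
  exact/smooth_coefficient/smooth_sigma_density.
set v := \matrix_k _.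
pose g h := (2 * b (row k0 A) u + h * b u u) *
            \prod_(k | k != k0) b (row k A) (row k A).
pose F (B : 'M[R]_(i, n)) : R := \det (gram b B).
pose G (B : 'M[R]_(i, n)) : R := (\det (gram (dot R n) B))^-1.
have oF : open (@frames R i n) by exact: open_frames.
have sF : smooth_on (@frames R i n) F by exact: smooth_on_gram.
have sG : smooth_on (@frames R i n) G.
  apply: smooth_onV => //; last exact: smooth_on_gram.
  by move=> B fB; rewrite det_gram_dot.
have dF : derivable F A v by have [_ /(_ v)[+ _]] := sF 1%N; apply.
have dG : derivable G A v by have [_ /(_ v)[+ _]] := sG 1%N; apply.
have F0 : F A = 0 by exact: gram_corank1 cA.
have -> : 'D_v (pullback (coefficient (@sigma_density R i n b))) A = 'D_v (F * G) A.
  apply: near_eq_derive; apply: (near_frames fA) => B fB.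
  rewrite (pullback_frame _ fB) (@coefficient_rows _ _ _ _ _ B) //.
    by rewrite (@sigma_density_rows _ _ _ _ (Gr_span fB)).
  exact: sigma_density_fiber.
rewrite deriveM // F0 scale0r add0r.
have -> : 'D_v F A = g 0.
  apply: derive_line => [|h]; last by rewrite F0 add0r /F gram_line.
  apply: cvgM; last exact: cvg_cst.
  by apply: cvgD; [exact: cvg_cst|apply: cvgM; [exact: cvg_id|exact: cvg_cst]].
rewrite /g mul0r addr0 /GRing.scale /= !mulf_neq0 ?invr_eq0 //.
- by rewrite det_gram_dot.
- by apply/prodf_neq0 => k; exact: An.
Qed.
End Orbit.

Theorem proposition3p7 (R : realType) (p q n i : nat) (hn : n = (p + q)%N)
  (b : {symmetric 'rV[R]_n})
  (b_nondegenerate : nondegenerate b)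
  (b_signature : has_signature b fullv p q)
  (hi : (1 <= i <= n - 1)%N) :
  forall r s : nat, (r + s = i - 1)%N ->
    defining_density (sigma_density (i:=i) b) (signature_orbit (i:=i) b r s).
Proof.
move=> r s rs; have i0 : (0 < i)%N by case/andP: hi.
split; first exact: smooth_sigma_density.
  by exists (@vol_connection R i n); exact: vol_connectionP.
move=> V /(orbit_frame i0 rs)[A [k0 [AV cA]]].
have s0 : @sigma_density R i n b V = (fun _ _ => 0).
  have db := sigma_density_fiber b V.
  rewrite coefficientE // (@coefficient_rows _ _ _ _ _ A) //.
  rewrite sigma_density_rows // (gram_corank1 cA) mul0r.
  by apply/funext => v; apply/funext => w; rewrite mul0r.
split=> // nabla cn.
have [u [bu ou]] := adapted_direction b_nondegenerate cA.
apply: (connection_onto cn (tangent_frame_derivation _ AV)) s0 _.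
  exact: smooth_sigma_density.
exact: coefficient_derivation AV cA bu ou.
Qed.
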